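(* Let $F=\frac1n\sum_{i=1}^nF_i$ be $\mu$-quasi-strongly monotone with $\mu>0$. Assume that there is $\widehat\ell>0$ such that for all $x\in\mathbb{R}^d$, with $x^*=\mathrm{proj}_{X^*}(x)$, $$\frac1n\sum_{i=1}^n\|F_i(x)-F_i(x^* )\|^2\le\widehat\ell\,\langle F(x)-F(x^* ),x-x^*\rangle,$$ that $X^*=\{x^*\}$ is a singleton, and that $0<\gamma\le\frac1{6\widehat\ell}$. Then for all $k\ge0$ the iterates produced by L-SVRGDA satisfy $$\mathbb{E}\|x^k-x^*\|^2\le\left(1-\min\left\{\gamma\mu,\frac p2\right\}\right)^kV_0,\qquad V_0=\|x^0-x^*\|^2+\frac{4\gamma^2\sigma_0^2}{p},$$ where $\sigma_0^2=\frac1n\sum_{i=1}^n\|F_i(w^0)-F_i(x^* )\|^2$.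
   Context: Norms and inner products on $\mathbb{R}^d$ are Euclidean. $F,F_1,\dots,F_n:\mathbb{R}^d\to\mathbb{R}^d$ are operators and $R:\mathbb{R}^d\to\mathbb{R}\cup\{+\infty\}$ is a proper lower semicontinuous convex function. $X^*$ is the (nonempty) set of solutions of the regularized variational inequality: find $x^*\in\mathbb{R}^d$ with $\langle F(x^* ),x-x^*\rangle+R(x)-R(x^* )\ge0$ for all $x\in\mathbb{R}^d$. $\mathrm{proj}_{X^*}(x)=\arg\min_{y\in X^*}\|y-x\|$. $F$ is $\mu$-quasi-strongly monotone if $\langle F(x)-F(x^* ),x-x^*\rangle\ge\mu\|x-x^*\|^2$ for all $x\in\mathbb{R}^d$, where $x^*=\mathrm{proj}_{X^*}(x)$. L-SVRGDA, with $p\in(0,1]$, deterministic $x^0\in\mathbb{R}^d$ and $w^0=x^0$: at each iteration $k\ge0$ draw $j_k$ uniformly from $\{1,\dots,n\}$ (independently of the past), set $g^k=F_{j_k}(x^k)-F_{j_k}(w^k)+F(w^k)$; $w^{k+1}=x^k$ with probability $p$ and $w^{k+1}=w^k$ with probability $1-p$; and $x^{k+1}=\mathrm{prox}_{\gamma R}(x^k-\gamma g^k)$, where $\mathrm{prox}_{\gamma R}(x)=\arg\min_{y}\{R(y)+\|y-x\|^2/(2\gamma)\}$. *)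

(* Defs.v *)
From HB Require Import structures.
From mathcomp Require Import all_boot all_order all_algebra finmap.
From mathcomp Require Import all_classical all_reals all_analysis.

Set Implicit Arguments.
Unset Strict Implicit.
Unset Printing Implicit Defensive.

Import Order.TTheory GRing.Theory Num.Theory.
Import numFieldNormedType.Exports.

Local Open Scope classical_set_scope.
Local Open Scope ring_scope.

(* The library norm on ['rV[R]_d] is the sup norm, whence the Euclidean one
   here; both induce the same topology. *)
Definition dotv (R : realType) (d : nat) (u v : 'rV[R]_d) : R :=
  \sum_(i < d) u 0 i * v 0 i.

Definition enorm (R : realType) (d : nat) (u : 'rV[R]_d) : R :=
  Num.sqrt (dotv u u).

Definition argmin (R : realType) (d : nat) (A : set 'rV[R]_d)
    (f : 'rV[R]_d -> \bar R) : set 'rV[R]_d :=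
  [set y | A y /\ forall z, A z -> (f y <= f z)%E].

(* The default value [0] is returned when there is no minimizer. *)
Definition eproj (R : realType) (d : nat) (X : set 'rV[R]_d)
    (x : 'rV[R]_d) : 'rV[R]_d :=
  xget 0 (argmin X (fun y => (enorm (y - x))%:E)).

Definition prox (R : realType) (d : nat) (gamma : R) (Reg : 'rV[R]_d -> \bar R)
    (x : 'rV[R]_d) : 'rV[R]_d :=
  xget 0 (argmin setT
    (fun y => (Reg y + (enorm (y - x) ^+ 2 / (2 * gamma))%:E)%E)).

(* A function to R U {+oo} is an extended-real function that avoids -oo. *)
Definition proper_fun (R : realType) (d : nat)
    (f : 'rV[R]_d -> \bar R) : Prop :=
  (forall x, (-oo < f x)%E) /\ (exists x, (f x < +oo)%E).

(* The library's [convex_function] is for real-valued functions.  For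
   [t = 0] or [t = 1] and an infinite value, recall that [0 * +oo = 0]. *)
Definition econvex (R : realType) (d : nat) (f : 'rV[R]_d -> \bar R) : Prop :=
  forall (x y : 'rV[R]_d) (t : R), 0 <= t -> t <= 1 ->
    (f (t *: x + (1 - t) *: y)%R <= t%:E * f x + (1 - t)%:E * f y)%E.

(* As [+oo - +oo = -oo] in the library, a point [xs] with [Reg xs = +oo] is
   not a solution when [Reg] is proper. *)
Definition rvi_sol (R : realType) (d : nat) (F : 'rV[R]_d -> 'rV[R]_d)
    (Reg : 'rV[R]_d -> \bar R) : set 'rV[R]_d :=
  [set xs | forall x : 'rV[R]_d,
    (0 <= (dotv (F xs) (x - xs))%:E + Reg x - Reg xs)%E].

Definition quasi_strongly_monotone (R : realType) (d : nat) (mu : R)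
    (X : set 'rV[R]_d) (F : 'rV[R]_d -> 'rV[R]_d) : Prop :=
  forall x : 'rV[R]_d, let xs := eproj X x in
    mu * enorm (x - xs) ^+ 2 <= dotv (F x - F xs) (x - xs).

Definition mutually_independent (d : measure_display) (T : measurableType d)
    (R : realType) (P : probability T R) (I : choiceType)
    (E : I -> set (set T)) : Prop :=
  forall (J : {fset I}) (A : I -> set T), (forall i, i \in J -> E i (A i)) ->
    P (\bigcap_(i in [set` J]) A i) = (\prod_(i <- J) P (A i))%E.

(* The sigma-algebra generated by a variable with values in a discrete space *)
Definition sigma_discrete (T U : Type) (f : T -> U) : set (set T) :=
  [set f @^-1` B | B in [set: set U]].

(* [j k] is the index drawn at iteration [k], and [c k] the coin that decides
   whether [w] is refreshed at iteration [k]. *)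
Record svrg_draws (d : measure_display) (T : measurableType d) (R : realType)
    (P : probability T R) (n : nat) (p : R)
    (j : nat -> T -> 'I_n) (c : nat -> T -> bool) : Prop := SvrgDraws {
  draws_index_measurable : forall k i, measurable [set t | j k t = i];
  draws_coin_measurable : forall k, measurable [set t | c k t];
  draws_index_uniform : forall k i, P [set t | j k t = i] = (n%:R^-1)%:E;
  draws_coin_bernoulli : forall k, P [set t | c k t] = p%:E;
  draws_independent : mutually_independent P (fun a : nat + nat =>
    match a with
    | inl k => sigma_discrete (j k)
    | inr k => sigma_discrete (c k)
    end)
}.

(* The pair (x^k, w^k) for given realizations of the draws *)
Fixpoint lsvrgda (R : realType) (d n : nat) (Fi : 'I_n -> 'rV[R]_d -> 'rV[R]_d)
    (F : 'rV[R]_d -> 'rV[R]_d) (Reg : 'rV[R]_d -> \bar R) (gamma : R)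
    (x0 : 'rV[R]_d) (j : nat -> 'I_n) (c : nat -> bool) (k : nat)
    : 'rV[R]_d * 'rV[R]_d :=
  if k is k'.+1 then
    let: (x, w) := lsvrgda Fi F Reg gamma x0 j c k' in
    let g := Fi (j k') x - Fi (j k') w + F w in
    (prox gamma Reg (x - gamma *: g), if c k' then x else w)
  else (x0, x0).

(* Main.v *)
Require Import Defs.
From HB Require Import structures.
From mathcomp Require Import all_boot all_order all_algebra finmap.
From mathcomp Require Import all_classical all_reals all_analysis.
From mathcomp Require Import measurable_realfun ring lra.

Set Implicit Arguments.
Unset Strict Implicit.
Unset Printing Implicit Defensive.

Import Order.TTheory GRing.Theory Num.Theory.
Import numFieldNormedType.Exports.

Local Open Scope classical_set_scope.
Local Open Scope ring_scope.

(** The solution [xs] is a fixed point of the exact proximal step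
    [y |-> prox (y - gamma *: F y)], and the proximal operator is nonexpansive;
    the minimizer defining it exists because the variational inequality gives
    [Reg] an affine minorant at [xs], so that the proximal objective has bounded
    sublevel sets.  Averaging over the draws of one iteration, and bounding the
    variance of the [w]-part of the estimator by its second moment, shows that
    [|x - xs|^2 + (4 gamma^2 / p) * mean_i |Fi w - Fi xs|^2] decreases by the
    factor [1 - min (gamma mu) (p / 2)].  Since the draws are independent and
    take finitely many values, the expectation is split along the cylinders
    fixing the first draws, where the state is constant. *)

(** * Euclidean inner product and existence of minimizers *)

Section EuclideanSpace.
Context (R : realType) (d : nat).
Implicit Types u v w : 'rV[R]_d.

Lemma dotvC u v : dotv u v = dotv v u.
Proof. by apply: eq_bigr => i _; rewrite mulrC. Qed.

Lemma dotvDl u v w : dotv (u + v) w = dotv u w + dotv v w.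
Proof. by rewrite -big_split; apply: eq_bigr => i _; rewrite mxE mulrDl. Qed.

Lemma dotvZl a u v : dotv (a *: u) v = a * dotv u v.
Proof. by rewrite mulr_sumr; apply: eq_bigr => i _; rewrite mxE mulrA. Qed.

Lemma dotvNl u v : dotv (- u) v = - dotv u v.
Proof. by rewrite -scaleN1r dotvZl mulN1r. Qed.

Lemma dotvDr u v w : dotv w (u + v) = dotv w u + dotv w v.
Proof. by rewrite dotvC dotvDl !(dotvC w). Qed.

Lemma dotvZr a u v : dotv v (a *: u) = a * dotv v u.
Proof. by rewrite dotvC dotvZl dotvC. Qed.

Lemma dotvNr u v : dotv v (- u) = - dotv v u.
Proof. by rewrite dotvC dotvNl dotvC. Qed.

Definition dotvE := (dotvDl, dotvDr, dotvNl, dotvNr, dotvZl, dotvZr).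

Lemma dotv_suml (I : finType) (f : I -> 'rV[R]_d) v :
  dotv (\sum_i f i) v = \sum_i dotv (f i) v.
Proof.
rewrite exchange_big; apply: eq_bigr => k _ /=.
by rewrite summxE mulr_suml.
Qed.

Lemma dotv_ge0 u : 0 <= dotv u u.
Proof. by apply: sumr_ge0 => i _; rewrite -expr2 sqr_ge0. Qed.

Lemma sqr_enorm u : enorm u ^+ 2 = dotv u u.
Proof. by rewrite sqr_sqrtr // dotv_ge0. Qed.

Lemma sqr_coord_le u (i : 'I_d) : u 0 i ^+ 2 <= dotv u u.
Proof.
rewrite /dotv (bigD1 i) //= -expr2 lerDl.
by apply: sumr_ge0 => k _; rewrite -expr2 sqr_ge0.
Qed.

Lemma continuous_sqr_enorm (a : 'rV[R]_d) :
  continuous (fun y : 'rV[R]_d => enorm (y - a) ^+ 2).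
Proof.
under eq_fun do rewrite sqr_enorm.
apply: continuous_big => [|i _ y]; first exact: add_continuous.
have coord : (z - a) 0 i @[z --> y] --> (y - a) 0 i.
  rewrite [X in _ --> X]mxE; under eq_fun do rewrite mxE.
  exact: (cvgD (@coord_continuous R 1 d 0 i y) (cvg_cst _)).
exact: (cvgM coord coord).
Qed.

(** The strict sublevel sets above the infimum [m] generate a proper filter containing [K], hence
    with a cluster point. Lower semicontinuity forbids a value above [m] there. *)
Lemma compact_sublevel_argmin (f : 'rV[R]_d -> \bar R) (K : set 'rV[R]_d) x1 :
  lower_semicontinuous f -> compact K ->
  [set y | (f y <= f x1)%E] `<=` K -> argmin setT f !=set0.
Proof.
move=> lscf cK subK.
have mle y : (ereal_inf (range f) <= f y)%E by apply: ereal_inf_lbound; exists y.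
set m := ereal_inf (range f) in mle.
have [fx1m|mfx1] := leP (f x1) m.
  by exists x1; split => // z _; exact: le_trans (mle z).
pose G := filter_from [set a | (m < a)%E] (fun a => [set y | (f y < a)%E]).
have PG : ProperFilter G.
  apply: filter_from_proper; first apply: filter_from_filter.
  - by exists (f x1).
  - move=> a b /= ma mb; exists (Order.min a b); first by rewrite /= lt_min ma.
    by move=> y /=; rewrite lt_min => /andP[].
  - by move=> a /ereal_inf_lt[_ [y _ <-] fya]; exists y.
have GK : G K.
  by exists (f x1) => // y /= /ltW; exact: subK.
have [z [_ clz]] := cK _ PG GK.
exists z; split => // x _; apply: le_trans (mle x).
rewrite leNgt; apply/negP => mfz.
have [a ma afz] : exists2 a : R, (m < a%:E)%E & (a%:E < f z)%E.
  case: (f z) mfz => [r||]; case: m {mle mfx1 G PG GK clz} => [s||] //.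
  - rewrite lte_fin => sr; exists ((s + r) / 2); rewrite lte_fin; lra.
  - by move=> _; exists (r - 1); rewrite ?ltNyr// lte_fin; lra.
  - by move=> _; exists (s + 1); rewrite ?ltry// lte_fin; lra.
  - by move=> _; exists 0; rewrite ?ltNyr ?ltry.
have [V Vz aV] := lscf z a afz.
have [y [/= fya /aV afy]] := clz _ _ (ex_intro2 _ _ a%:E ma (fun y h => h)) Vz.
by move: (lt_trans fya afy); rewrite ltxx.
Qed.

End EuclideanSpace.

Lemma lower_semicontinuousD_cont (R : realType) (X : topologicalType)
    (f : X -> \bar R) (g : X -> R) :
  lower_semicontinuous f -> continuous g ->
  lower_semicontinuous (fun y => (f y + (g y)%:E)%E).
Proof.
move=> lscf cg x a; rewrite -lteBlDr// -EFinB => afx.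
(* [b] splits the slack: near [x], [f] stays above [b] and [g] above [a - b]. *)
have [b ab bfx] : exists2 b : R, a - g x < b & (b%:E < f x)%E.
  case: (f x) afx => [r||] //.
  - rewrite lte_fin => h; exists ((a - g x + r) / 2); rewrite ?lte_fin; lra.
  - by move=> _; exists (a - g x + 1); rewrite ?ltry//; lra.
have [V Vx bV] := lscf x b bfx.
exists (V `&` [set y | a - b < g y]).
  apply: filterI => //.
  by apply: (cvgr_gt (g x) (cg x)); lra.
move=> y [/bV bfy /= aby].
rewrite -lteBlDr// -EFinB; apply: lt_trans bfy; rewrite lte_fin; lra.
Qed.

Lemma le0_of_le_scaled (R : realFieldType) (a q : R) :
  (forall t, 0 < t -> t <= 1 -> a <= t * q) -> a <= 0.
Proof.
move=> h; rewrite leNgt; apply/negP => a0.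
have aq : a <= q by have := h 1 ltr01 (lexx 1); rewrite mul1r.
have aq0 : 0 < a + q by lra.
(* This [t] replaces the limit at 0: it would give [a <= a * q / (a + q)], which is less than
   [a]. *)
have := h (a / (a + q)) (divr_gt0 a0 aq0).
rewrite ler_pdivrMr// mul1r lerDl => /(_ (ltW (lt_le_trans a0 aq))).
rewrite mulrAC ler_pdivlMr// ; nra.
Qed.

(** * The proximal operator: existence and optimality condition *)

Section Prox.
Context (R : realType) (d : nat) (Reg : 'rV[R]_d -> \bar R) (gamma : R).
Hypothesis gamma0 : 0 < gamma.
Implicit Types u x y z g : 'rV[R]_d.

Let obj u y : \bar R := (Reg y + (enorm (y - u) ^+ 2 / (2 * gamma))%:E)%E.

Lemma prox_argmin u z g (r : R) : lower_semicontinuous Reg ->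
  Reg z = r%:E -> (forall y, ((r + dotv g (y - z))%:E <= Reg y)%E) ->
  argmin setT (obj u) (prox gamma Reg u).
Proof.
move=> lscR Rz minor; apply: xgetPex.
pose M := r + dotv (z - u) (z - u) / (2 * gamma).
(* Young's inequality gives [- dotv g (y - u) <= gamma |g|^2 + |y - u|^2 / (4 gamma)],
   so [|y - u|^2 <= B] on the sublevel set of [z]. *)
pose B := 4 * gamma * (M + gamma * dotv g g - dotv g (u - z) - r).
apply: (@compact_sublevel_argmin _ _ _
  [set y : 'rV[R]_d | forall i, `[u 0 i - (B + 1), u 0 i + (B + 1)]%classic (y 0 i)] z).
- apply: lower_semicontinuousD_cont => // y.
  exact: (cvgM (@continuous_sqr_enorm _ _ u y) (cvg_cst _)).
- by apply: (@rV_compact _ _ (fun i => `[u 0 i - (B + 1), u 0 i + (B + 1)]%classic))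
    => i; exact: segment_compact.
move=> y /= objy i.
have /= : (((r + dotv g (y - z))%:E + (enorm (y - u) ^+ 2 / (2 * gamma))%:E)
    <= M%:E)%E.
  apply: le_trans (le_trans objy _); first by rewrite leeD2r.
  by rewrite Rz -EFinD sqr_enorm.
rewrite -EFinD lee_fin sqr_enorm => h.
(* Divided by [4 * gamma], this square is the Young inequality above. *)
have q0 := dotv_ge0 ((2 * gamma) *: g + (y - u)).
have yuB : dotv (y - u) (y - u) <= B.
  have gamma4 : 0 < 4 * gamma by rewrite mulr_gt0.
  move: h; rewrite -(ler_pM2r gamma4).
  rewrite [X in X <= _](_ : _ = 4 * gamma * (r + dotv g (y - z)) +
    2 * dotv (y - u) (y - u)); last by field; exact: lt0r_neq0.
  move: q0; rewrite /B !dotvE (dotvC y g) (dotvC u g); lra.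
have := le_trans (sqr_coord_le (y - u) i) yuB.
rewrite !mxE in_itv /= => yB.
have B0 : 0 <= B by apply: le_trans yB; exact: sqr_ge0.
(* [B + 1] stands in for the square root of [B], since [B <= (B + 1) ^+ 2]. *)
have : `|y 0 i - u 0 i| <= B + 1.
  rewrite -ler_sqr ?nnegrE ?addr_ge0// real_normK ?num_real//; nra.
by rewrite ler_norml => /andP[? ?]; apply/andP; split; lra.
Qed.

(** First-order optimality without subgradients: compare [y] with the point [t *: z + (1 - t) *: y],
    use convexity, divide by [t] and let [t] tend to 0. *)
Lemma argmin_prox_vi u y z (ry rz : R) : econvex Reg ->
  argmin setT (obj u) y -> Reg y = ry%:E -> Reg z = rz%:E ->
  ry + dotv (u - y) (z - y) / gamma <= rz.
Proof.
move=> cvxR [_ miny] Ry Rz; rewrite -subr_le0.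
apply: (@le0_of_le_scaled _ _ (dotv (z - y) (z - y) / (2 * gamma))) => t t0 t1.
have := miny (t *: z + (1 - t) *: y) I.
rewrite /obj Ry => h.
have := le_trans h (leeD2r _ (cvxR z y t (ltW t0) t1)).
rewrite Rz Ry -!EFinM -!EFinD lee_fin !sqr_enorm.
have -> : t *: z + (1 - t) *: y - u = (y - u) + t *: (z - y).
  by apply/rowP => i; rewrite !mxE; ring.
have -> : dotv (u - y) (z - y) = - dotv (y - u) (z - y).
  by rewrite -dotvNl opprB.
move: (y - u) (z - y) => v w; rewrite !dotvE (dotvC w v) => hh.
rewrite -(ler_pM2l t0).
rewrite -subr_ge0; move: hh; rewrite -[(_ + _ <= _ + _)%R]subr_ge0.
move/le_trans; apply; rewrite le_eqVlt; apply/predU1P; left.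
by field; exact: lt0r_neq0.
Qed.

Lemma argmin_prox_fin u y z (r : R) : proper_fun Reg -> Reg z = r%:E ->
  argmin setT (obj u) y -> exists s : R, Reg y = s%:E.
Proof.
move=> [noNy _] Rz [_ /(_ z I)]; rewrite /obj Rz.
have := noNy y; case: (Reg y) => [s||] //; first by exists s.
Qed.

End Prox.

(** * Solutions of the variational inequality and the proximal step *)

Section Solutions.
Context (R : realType) (d : nat) (F : 'rV[R]_d -> 'rV[R]_d)
  (Reg : 'rV[R]_d -> \bar R).
Implicit Types x y g : 'rV[R]_d.

(** Testing the inequality at a point where [Reg] is finite forces [Reg xs] to be finite; the
    inequality then rearranges into the minorant. *)
Lemma rvi_sol_minorant xs : proper_fun Reg -> rvi_sol F Reg xs ->
  exists2 r : R, Reg xs = r%:E &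
    forall y, ((r + dotv (- F xs) (y - xs))%:E <= Reg y)%E.
Proof.
move=> [noNy [z Rz]] sol.
have [r Rxs] : exists r : R, Reg xs = r%:E.
  have := sol z; have := noNy xs; have := noNy z.
  case: (Reg xs) => [r||] //; first by exists r.
  by case: (Reg z) Rz.
exists r => // y; have := sol y; have := noNy y; rewrite Rxs.
case: (Reg y) => [s||] //=; last by move=> _ _; rewrite leey.
by rewrite !lee_fin dotvNl => _; lra.
Qed.

(* The point [xs] is the proximal point of [xs - gamma *: F xs], and the
   proximal operator is nonexpansive. *)
Lemma prox_step_le gamma xs x g : 0 < gamma -> proper_fun Reg ->
  lower_semicontinuous Reg -> econvex Reg -> rvi_sol F Reg xs ->
  enorm (prox gamma Reg (x - gamma *: g) - xs) ^+ 2 <=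
  enorm (x - xs - gamma *: (g - F xs)) ^+ 2.
Proof.
move=> gamma0 propR lscR cvxR sol.
have [r Rxs minor] := rvi_sol_minorant propR sol.
set u := x - gamma *: g.
have miny := prox_argmin gamma0 u lscR Rxs minor.
have [ry Ry] := argmin_prox_fin propR Rxs miny.
have vi := argmin_prox_vi gamma0 cvxR miny Ry Rxs.
set y := prox gamma Reg u in miny Ry vi *.
have := minor y; rewrite Ry lee_fin => h.
(* Optimality of [y] tested at [xs], added to the minorant at [y], eliminates the values of
   [Reg]. *)
have : dotv (u - y) (xs - y) - gamma * dotv (F xs) (y - xs) <= 0.
  have : dotv (u - y) (xs - y) / gamma <= dotv (F xs) (y - xs).
    by move: h; rewrite dotvNl; lra.
  by rewrite ler_pdivrMr// => ?; lra.
rewrite !sqr_enorm.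
have -> : u - y = (x - xs - gamma *: (g - F xs)) - (y - xs) - gamma *: F xs.
  by apply/rowP => i; rewrite !mxE; ring.
rewrite -(opprB y xs).
(* The [F xs] terms cancel and leave [dotv e e <= dotv v e]; with [0 <= dotv (v - e) (v - e)] this
   bounds [dotv e e] by [dotv v v]. *)
move: (x - xs - _) (y - xs) => v e.
have := dotv_ge0 (v - e); rewrite !dotvE (dotvC e v); nra.
Qed.

End Solutions.

(** * One-step decrease of the Lyapunov function *)

Section LyapunovStep.
Context (R : realType) (d n : nat) (Fi : 'I_n -> 'rV[R]_d -> 'rV[R]_d)
  (F : 'rV[R]_d -> 'rV[R]_d) (Reg : 'rV[R]_d -> \bar R) (gamma p : R)
  (xs : 'rV[R]_d).

Definition lsvrgda_step (s : 'rV[R]_d * 'rV[R]_d) (a : 'I_n * bool) :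
    'rV[R]_d * 'rV[R]_d :=
  (prox gamma Reg (s.1 - gamma *: (Fi a.1 s.1 - Fi a.1 s.2 + F s.2)),
   if a.2 then s.1 else s.2).

Definition mean_sqr_dev (w : 'rV[R]_d) : R :=
  n%:R^-1 * \sum_(i < n) enorm (Fi i w - Fi i xs) ^+ 2.

(** With weight [4 * gamma ^+ 2 / p], a refresh of probability [p] removes
    [4 * gamma ^+ 2 * mean_sqr_dev s.2] on average: half absorbs the estimator noise, half gives the
    rate [p / 2]. *)
Definition lyapunov (s : 'rV[R]_d * 'rV[R]_d) : R :=
  enorm (s.1 - xs) ^+ 2 + 4 * gamma ^+ 2 * mean_sqr_dev s.2 / p.

Definition draw_weight (a : 'I_n * bool) : R :=
  n%:R^-1 * (if a.2 then p else 1 - p).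

Lemma mean_sqr_dev_ge0 w : 0 <= mean_sqr_dev w.
Proof. by rewrite mulr_ge0 ?invr_ge0// sumr_ge0// => i _; exact: sqr_ge0. Qed.

Lemma sqr_enorm_le_lyapunov s : 0 < p -> enorm (s.1 - xs) ^+ 2 <= lyapunov s.
Proof.
move=> p0; rewrite lerDl divr_ge0 ?(ltW p0)// mulr_ge0 ?mean_sqr_dev_ge0//.
by rewrite mulr_ge0 ?sqr_ge0.
Qed.

Lemma lyapunov_ge0 s : 0 < p -> 0 <= lyapunov s.
Proof.
by move=> p0; apply: le_trans (sqr_enorm_le_lyapunov s p0); exact: sqr_ge0.
Qed.

Hypothesis n0 : (0 < n)%N.
Hypothesis hF : forall x, F x = n%:R^-1 *: \sum_(i < n) Fi i x.

Let nV : (n%:R^-1 * n%:R : R) = 1.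
Proof. by rewrite mulVf// pnatr_eq0 -lt0n. Qed.

Lemma mean_dotvB x y v :
  n%:R^-1 * (\sum_(i < n) dotv (Fi i x - Fi i y) v) = dotv (F x - F y) v.
Proof.
by rewrite -dotv_suml sumrB -dotvZl scalerBr -!hF.
Qed.

(** The direction is [u - (v - m)], where [u] and [v] are the deviations of [Fi i] at [x] and [w]
    from its value at [xs], and [m] is the mean of [v]. Its square is at most twice the sum of the
    two squares, and the cross terms of [v] and [m] with [x - xs] cancel on average. *)
Lemma mean_sqr_step_le x w :
  n%:R^-1 * (\sum_(i < n)
    enorm (x - xs - gamma *: (Fi i x - Fi i w + F w - F xs)) ^+ 2) <=
  enorm (x - xs) ^+ 2 - 2 * gamma * dotv (F x - F xs) (x - xs) +
  2 * gamma ^+ 2 * (mean_sqr_dev x + mean_sqr_dev w).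
Proof.
set a := x - xs; set m := F w - F xs.
pose Du i := dotv (Fi i x - Fi i xs) a.
pose Dv i := dotv (Fi i w - Fi i xs) a.
pose Dm i := dotv (Fi i w - Fi i xs) m.
pose Su i := enorm (Fi i x - Fi i xs) ^+ 2.
pose Sv i := enorm (Fi i w - Fi i xs) ^+ 2.
(* [K] gathers the terms free of [i], kept opaque so that splitting the sum leaves it whole. *)
have [K KE] : exists K, K =
    enorm a ^+ 2 - 2 * gamma * dotv m a + 2 * gamma ^+ 2 * dotv m m by eexists.
have pointwise i :
    enorm (a - gamma *: (Fi i x - Fi i w + F w - F xs)) ^+ 2 <=
    K + - 2 * gamma * Du i + 2 * gamma * Dv i + 2 * gamma ^+ 2 * Su i +
    2 * gamma ^+ 2 * Sv i + (- 4 * gamma ^+ 2) * Dm i.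
  rewrite KE /Du /Dv /Dm /Su /Sv; clear Du Dv Dm Su Sv K KE.
  have -> : Fi i x - Fi i w + F w - F xs =
      (Fi i x - Fi i xs) - (Fi i w - Fi i xs) + m.
    by apply/rowP => k; rewrite !mxE; ring.
  move: (Fi i x - Fi i xs) (Fi i w - Fi i xs) a m => u v b z.
  have := mulr_ge0 (sqr_ge0 gamma) (dotv_ge0 (u + v - z)).
  rewrite !sqr_enorm !dotvE (dotvC b u) (dotvC b v) (dotvC b z).
  rewrite (dotvC v u) (dotvC z u) (dotvC z v); lra.
have := @ler_sum _ _ (index_enum _) xpredT _ _ (fun i _ => pointwise i).
rewrite !big_split /= -!mulr_sumr sumr_const card_ord -[K *+ _]mulr_natl => h.
have n0R : 0 < n%:R^-1 :> R by rewrite invr_gt0 ltr0n.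
have := ler_wpM2l (ltW n0R) h.
have DuE : n%:R^-1 * \sum_(i < n) Du i = dotv (F x - F xs) a by exact: mean_dotvB.
have DvE : n%:R^-1 * \sum_(i < n) Dv i = dotv m a by exact: mean_dotvB.
have DmE : n%:R^-1 * \sum_(i < n) Dm i = dotv m m by exact: mean_dotvB.
have SuE : n%:R^-1 * \sum_(i < n) Su i = mean_sqr_dev x by [].
have SvE : n%:R^-1 * \sum_(i < n) Sv i = mean_sqr_dev w by [].
move/le_trans; apply.
rewrite !mulrDr mulrA nV mul1r.
rewrite !(mulrCA n%:R^-1) DuE DvE DmE SuE SvE KE.
(* The dropped term is [- 2 * gamma ^+ 2 * dotv m m]: variance is at most second moment. *)
have := mulr_ge0 (sqr_ge0 gamma) (dotv_ge0 m); lra.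
Qed.

(** The deviation at [s.1] enters with total weight [(2 + 4) * gamma ^+ 2]. As
    [6 * gamma * ell <= 1], it uses up at most half of the gain [2 * gamma * D], with [D] the inner
    product in the hypotheses; quasi-strong monotonicity turns the other half into the rate
    [gamma * mu]. *)
Lemma lyapunov_step mu ell s :
  proper_fun Reg -> lower_semicontinuous Reg -> econvex Reg ->
  rvi_sol F Reg xs -> 0 < ell -> 0 < gamma -> gamma <= (6 * ell)^-1 ->
  0 < p -> p <= 1 ->
  mu * enorm (s.1 - xs) ^+ 2 <= dotv (F s.1 - F xs) (s.1 - xs) ->
  mean_sqr_dev s.1 <= ell * dotv (F s.1 - F xs) (s.1 - xs) ->
  \sum_a draw_weight a * lyapunov (lsvrgda_step s a) <=
  (1 - Num.min (gamma * mu) (p / 2)) * lyapunov s.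
Proof.
case: s => x w /= propR lscR cvxR sol ell0 gamma0 gammale p0 p1 qsm coco.
have pn0 : p != 0 by rewrite gt_eqF.
pose next i := enorm (prox gamma Reg
  (x - gamma *: (Fi i x - Fi i w + F w)) - xs) ^+ 2.
(* Averaging over the coin; on a refresh the probability [p] cancels the [p] in the denominator. *)
have -> : \sum_a draw_weight a * lyapunov (lsvrgda_step (x, w) a) =
    n%:R^-1 * (\sum_(i < n) next i) +
    4 * gamma ^+ 2 * mean_sqr_dev x +
    4 * gamma ^+ 2 * (1 - p) * mean_sqr_dev w / p.
  pose f (i : 'I_n) (b : bool) :=
    draw_weight (i, b) * lyapunov (lsvrgda_step (x, w) (i, b)).
  rewrite (eq_bigr (fun a => f a.1 a.2)); last by case.
  rewrite -(pair_bigA _ f) /=.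
  pose C := 4 * gamma ^+ 2 * mean_sqr_dev x +
    4 * gamma ^+ 2 * (1 - p) * mean_sqr_dev w / p.
  rewrite (eq_bigr (fun i => n%:R^-1 * (next i + C))) => [|i _].
    rewrite -mulr_sumr big_split /= sumr_const card_ord -[C *+ _]mulr_natl.
    by rewrite mulrDr (mulrA _ n%:R C) nV mul1r addrA.
  rewrite big_bool /f /draw_weight /lyapunov /= -/(next i) /C.
  by field; rewrite pn0 pnatr_eq0 -lt0n.
have nextle : n%:R^-1 * (\sum_(i < n) next i) <=
    enorm (x - xs) ^+ 2 - 2 * gamma * dotv (F x - F xs) (x - xs) +
    2 * gamma ^+ 2 * (mean_sqr_dev x + mean_sqr_dev w).
  apply: le_trans (mean_sqr_step_le x w).
  rewrite ler_wpM2l ?invr_ge0// ler_sum// => i _.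
  exact: prox_step_le.
have gell : gamma * ell <= 6^-1.
  have := ler_wpM2r (ltW ell0) gammale.
  by rewrite invfM -mulrA mulVf ?mulr1// gt_eqF.
rewrite /lyapunov /=.
set D := dotv _ _ in qsm coco nextle *.
set A := enorm _ ^+ 2 in qsm nextle *.
set S := mean_sqr_dev w in nextle *.
set U := mean_sqr_dev x in coco nextle *.
have A0 : 0 <= A by exact: sqr_ge0.
have S0 : 0 <= S by exact: mean_sqr_dev_ge0.
have U0 : 0 <= U by exact: mean_sqr_dev_ge0.
have D0 : 0 <= D by rewrite -(pmulr_rge0 _ ell0); exact: le_trans coco.
pose th := Num.min (gamma * mu) (p / 2).
have th1 : th * A <= gamma * mu * A by rewrite ler_wpM2r// ge_min lexx.
have SP0 : 0 <= 4 * gamma ^+ 2 * S / p.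
  by rewrite divr_ge0 ?(ltW p0)// mulr_ge0// mulr_ge0 ?sqr_ge0.
have th2 : th * (4 * gamma ^+ 2 * S / p) <= 2 * gamma ^+ 2 * S.
  have -> : 2 * gamma ^+ 2 * S = p / 2 * (4 * gamma ^+ 2 * S / p) by field.
  by rewrite ler_wpM2r// ge_min lexx orbT.
have gU : gamma ^+ 2 * U <= 6^-1 * (gamma * D).
  apply: le_trans (_ : gamma * ell * (gamma * D) <= _).
    by rewrite [leRHS]mulrACA -expr2 ler_wpM2l ?sqr_ge0.
  by rewrite ler_wpM2r// mulr_ge0// ltW.
have gq : gamma * (mu * A) <= gamma * D by rewrite ler_wpM2l// ltW.
have -> : 4 * gamma ^+ 2 * (1 - p) * S / p =
    4 * gamma ^+ 2 * S / p - 4 * gamma ^+ 2 * S by field.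
rewrite -/th; move: SP0 th2; set SP := _ / p => SP0 th2; lra.
Qed.

End LyapunovStep.

(** * Expectations along a recursion driven by finite-valued draws *)

Section FiniteDraws.
Context (disp : measure_display) (T : measurableType disp) (R : realType)
  (P : probability T R) (U : finType) (u : nat -> T -> U) (wt : U -> R).
Context (S : Type) (step : S -> U -> S) (s0 : S).

Fixpoint run (a : nat -> U) (k : nat) : S :=
  if k is k'.+1 then step (run a k') (a k') else s0.

Definition cylinder (a : nat -> U) (m : nat) : set T :=
  [set t | forall i, (i < m)%N -> u i t = a i].

Lemma eq_run a b m : (forall i, (i < m)%N -> a i = b i) -> run a m = run b m.
Proof.
elim: m => //= m IH ab; rewrite IH ?ab// => i im.
by apply: ab; exact: ltnW.
Qed.

Hypothesis mu_draw : forall k x, measurable [set t | u k t = x].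
Hypothesis P_cylinder :
  forall a m, P (cylinder a m) = (\prod_(i < m) wt (a i))%:E.

Lemma measurable_cylinder a m : measurable (cylinder a m).
Proof.
have -> : cylinder a m = \bigcap_(i in [set i | (i < m)%N]) [set t | u i t = a i].
  by [].
by apply: bigcap_measurableType => i _.
Qed.

(** [S] needs no sigma-algebra: the state depends on finitely many finite-valued draws, so splitting
    on the last draw reduces to an earlier state. *)
Lemma measurable_run m (B : set S) : measurable [set t | B (run (u ^~ t) m)].
Proof.
elim: m B => [|m IH] B /=.
  have [h|h] := pselect (B s0).
    by rewrite (_ : [set _ | _] = setT)// -subTset.
  by rewrite (_ : [set _ | _] = set0)// -subset0.
rewrite (_ : [set _ | _] = \big[setU/set0]_(x : U)
  ([set t | B (step (run (u ^~ t) m) x)] `&` [set t | u m t = x])).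
  by apply: bigsetU_measurable => x _; apply: measurableI => //; exact: (IH (B \o step ^~ x)).
rewrite -bigcup_seq; apply/seteqP; split => t /=.
  by move=> Bt; exists (u m t) => //=; rewrite mem_index_enum.
by move=> [x _ [/= ? ->]].
Qed.

Lemma measurable_fun_run m (phi : S -> R) (D : set T) :
  measurable_fun D (EFin \o (fun t => phi (run (u ^~ t) m))).
Proof.
move=> mD B mB; apply: measurableI => //.
exact: (measurable_run m (fun s => B (phi s)%:E)).
Qed.

Lemma cylinderS a m x :
  cylinder (fun i => if i == m then x else a i) m.+1 =
  cylinder a m `&` [set t | u m t = x].
Proof.
apply/seteqP; split => t /=.
  move=> h; split=> [i im|]; last by rewrite h ?eqxx.
  by rewrite h ?ltn_eqF// ltnW.
move=> [h hm] i; rewrite ltnS leq_eqVlt => /predU1P[->|im]; first by rewrite eqxx.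
by rewrite ltn_eqF// h.
Qed.

Context (phi : S -> R) (rho : R).
Hypothesis phi0 : forall s, 0 <= phi s.
Hypothesis rho0 : 0 <= rho.
Hypothesis drift : forall s, \sum_x wt x * phi (step s x) <= rho * phi s.

(** Cylinders replace conditional expectation. The induction frees [a] and [m]: fixing draw [m]
    splits the cylinder into longer ones with one step less to run, and their bounds sum up by
    [drift] at the constant state [run a m]. *)
Lemma integral_cylinder_run_le k a m :
  (\int[P]_(t in cylinder a m) (phi (run (u ^~ t) (m + k)))%:E <=
  (rho ^+ k * phi (run a m) * \prod_(i < m) wt (a i))%:E)%E.
Proof.
elim: k a m => [|k IH] a m.
  rewrite addn0 expr0 mul1r (eq_integral (cst (phi (run a m))%:E)).
    rewrite integral_cst; last exact: measurable_cylinder.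
    by rewrite [X in (_ * X <= _)%E](P_cylinder a m) -EFinM.
  by move=> t /set_mem at_; rewrite /= (eq_run at_).
pose ext x i := if i == m then x else a i.
have extS x := cylinderS a m x : cylinder (ext x) m.+1 = _.
have split_cyl : cylinder a m = \big[setU/set0]_(x : U) cylinder (ext x) m.+1.
  rewrite -bigcup_seq; apply/seteqP; split => t /=.
    move=> h; exists (u m t); first by rewrite /= mem_index_enum.
    by rewrite extS.
  by move=> [x _]; rewrite extS => -[].
rewrite split_cyl ge0_integral_bigsetU/=; last 5 first.
- by move=> x; exact: measurable_cylinder.
- exact: index_enum_uniq.
- move=> x y _ _ [t []]; rewrite /= !extS => -[_ /= <-] [_ /= <-] //.
- exact: measurable_fun_run.
- by move=> t _; rewrite lee_fin.
rewrite addnS -addSn.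
apply: le_trans (lee_sum _ (fun x _ => IH (ext x) m.+1)) _.
rewrite sumEFin lee_fin.
(* No sign is assumed on [wt], but this product is a probability. *)
have w0 : 0 <= \prod_(i < m) wt (a i).
  by rewrite -lee_fin -P_cylinder measure_ge0.
rewrite (eq_bigr (fun x => rho ^+ k * \prod_(i < m) wt (a i) *
    (wt x * phi (step (run a m) x)))).
  rewrite -mulr_sumr exprSr.
  have := ler_wpM2l (mulr_ge0 (exprn_ge0 k rho0) w0) (drift (run a m)).
  by move/le_trans; apply; rewrite le_eqVlt; apply/predU1P; left; ring.
move=> x _; rewrite big_ord_recr /= /ext eqxx.
rewrite (@eq_run _ a) => [|i im]; last by rewrite ltn_eqF.
rewrite (eq_bigr (fun i : 'I_m => wt (a i))) => [|i _]; last by rewrite ltn_eqF.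
by ring.
Qed.

Lemma integral_run_le k :
  (\int[P]_t (phi (run (u ^~ t) k))%:E <= (rho ^+ k * phi s0)%:E)%E.
Proof.
(* A sample point supplies some sequence of draws, as the empty cylinder condition still takes one
   as argument. *)
have [t0 _] : exists t : T, True.
  apply/not_existsP => noT; have := probability_setT P.
  rewrite (_ : setT = set0) ?measure0; last by apply/seteqP; split => // t; have := noT t.
  by case=> /eqP; rewrite eq_sym oner_eq0.
have := integral_cylinder_run_le k (u ^~ t0) 0.
rewrite big_ord0 mulr1 add0n (_ : cylinder _ 0 = setT)//.
by apply/seteqP; split.
Qed.

End FiniteDraws.

(** * The law of the indices and coins *)

Section SvrgDraws.
Context (disp : measure_display) (T : measurableType disp) (R : realType)
  (P : probability T R) (n : nat) (p : R)
  (j : nat -> T -> 'I_n) (c : nat -> T -> bool).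
Hypothesis hdraws : svrg_draws P p j c.

Let u k t := (j k t, c k t).

Lemma measurable_coin_eq k b : measurable [set t | c k t = b].
Proof.
case: b; first exact: (draws_coin_measurable hdraws).
rewrite (_ : [set _ | _] = ~` [set t | c k t]).
  exact/measurableC/(draws_coin_measurable hdraws).
by apply/seteqP; split => t /=; [move=> -> | move/negP/negbTE].
Qed.

Lemma measurable_draw k x : measurable [set t | u k t = x].
Proof.
rewrite (_ : [set _ | _] = [set t | j k t = x.1] `&` [set t | c k t = x.2]).
  apply: measurableI; first exact: (draws_index_measurable hdraws).
  exact: measurable_coin_eq.
by apply/seteqP; split => t; case: x => i b; rewrite /u /= => -[-> ->].
Qed.

Lemma prob_coin k b :
  P [set t | c k t = b] = (if b then p else 1 - p)%:E.
Proof.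
case: b; first exact: (draws_coin_bernoulli hdraws).
rewrite (_ : [set _ | _] = ~` [set t | c k t]).
  rewrite probability_setC ?(draws_coin_bernoulli hdraws)//.
  exact: (draws_coin_measurable hdraws).
by apply/seteqP; split => t /=; [move=> -> | move/negP/negbTE].
Qed.

(** The cylinder is an intersection of [m] index events and [m] coin events; independence factors
    it, and the factors are regrouped in pairs. *)
Lemma prob_cylinder (a : nat -> 'I_n * bool) m :
  P (cylinder u a m) = (\prod_(i < m) draw_weight p (a i))%:E.
Proof.
pose s : seq (nat + nat) := [seq inl i | i <- iota 0 m] ++ [seq inr i | i <- iota 0 m].
pose A (x : nat + nat) : set T := match x with
  | inl i => [set t | j i t = (a i).1]
  | inr i => [set t | c i t = (a i).2] end.
have us : uniq s.
  rewrite cat_uniq !map_inj_uniq ?iota_uniq//=; try by move=> ? ? [].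
  by rewrite andbT; apply/hasPn => _ /mapP[i _ ->]; apply/mapP => -[].
have -> : cylinder u a m = \bigcap_(x in [set` [fset x in s]%fset]) A x.
  apply/seteqP; split => t /=.
    move=> h x /=; rewrite in_fset /= mem_cat => /orP[] /mapP[i];
      by rewrite mem_iota /= add0n => /h hi ->; rewrite /= -hi.
  move=> h i im; rewrite /u [RHS]surjective_pairing; congr pair.
    apply: (h (inl i)); rewrite /= in_fset mem_cat map_f// mem_iota//.
  by apply: (h (inr i)); rewrite /= in_fset mem_cat (map_f inr) ?orbT// mem_iota.
rewrite (draws_independent hdraws); last first.
  by case=> i _; [exists [set (a i).1] | exists [set (a i).2]].
rewrite (perm_big s) /=; last first.
  by apply: uniq_perm => [||x]; [exact: fset_uniq | exact: us | rewrite in_fset].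
rewrite big_cat /= !big_map -big_split /=.
have -> : iota 0 m = index_iota 0 m by rewrite /index_iota subn0.
rewrite big_mkord (big_morph EFin EFinM erefl).
apply: eq_bigr => i _.
by rewrite (draws_index_uniform hdraws) prob_coin.
Qed.

End SvrgDraws.

(** * Linear convergence of L-SVRGDA *)

Theorem theoremF4 (R : realType) (d n : nat) (hn : (0 < n)%N)
    (Fi : 'I_n -> 'rV[R]_d -> 'rV[R]_d) (F : 'rV[R]_d -> 'rV[R]_d)
    (hF : forall x, F x = n%:R^-1 *: \sum_(i < n) Fi i x)
    (Reg : 'rV[R]_d -> \bar R) (hproper : proper_fun Reg)
    (hlsc : lower_semicontinuous Reg) (hconvex : econvex Reg)
    (mu : R) (hmu : 0 < mu)
    (hqsm : quasi_strongly_monotone mu (rvi_sol F Reg) F)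
    (ell : R) (hell : 0 < ell)
    (hcoco : forall x : 'rV[R]_d, let xp := eproj (rvi_sol F Reg) x in
       n%:R^-1 * (\sum_(i < n) enorm (Fi i x - Fi i xp) ^+ 2)
         <= ell * dotv (F x - F xp) (x - xp))
    (xs : 'rV[R]_d) (hsol : rvi_sol F Reg = [set xs])
    (gamma : R) (hgamma0 : 0 < gamma) (hgamma : gamma <= (6 * ell)^-1)
    (p : R) (hp0 : 0 < p) (hp1 : p <= 1)
    (dT : measure_display) (T : measurableType dT) (P : probability T R)
    (j : nat -> T -> 'I_n) (c : nat -> T -> bool)
    (hdraws : svrg_draws P p j c) (x0 : 'rV[R]_d) (k : nat) :
  let x (m : nat) (t : T) : 'rV[R]_d :=
    (lsvrgda Fi F Reg gamma x0 (j ^~ t) (c ^~ t) m).1 in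
  let sigma0sq : R := n%:R^-1 * (\sum_(i < n) enorm (Fi i x0 - Fi i xs) ^+ 2) in
  let V0 : R := enorm (x0 - xs) ^+ 2 + 4 * gamma ^+ 2 * sigma0sq / p in
  ('E_P[fun t => (enorm (x k t - xs) ^+ 2)%R]
     <= ((1 - Num.min (gamma * mu) (p / 2)) ^+ k * V0)%:E)%E.
Proof.
cbv zeta.
have sol : rvi_sol F Reg xs by rewrite hsol.
(* On a singleton the minimizer exists, so the default 0 of [eproj] is never returned. *)
have projE y : eproj (rvi_sol F Reg) y = xs.
  rewrite hsol; apply: xget_unique; first by split=> // z ->.
  by move=> z [].
have drift s : \sum_a draw_weight p a *
    lyapunov Fi gamma p xs (lsvrgda_step Fi F Reg gamma s a) <=
    (1 - Num.min (gamma * mu) (p / 2)) * lyapunov Fi gamma p xs s.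
  apply: (lyapunov_step hn hF (mu := mu) (ell := ell)) => //.
    by have := hqsm s.1; rewrite /= projE.
  by have := hcoco s.1; rewrite /= projE.
have rho0 : 0 <= 1 - Num.min (gamma * mu) (p / 2).
  have : Num.min (gamma * mu) (p / 2) <= p / 2 by rewrite ge_min lexx orbT.
  lra.
pose u m t := (j m t, c m t).
have runE m t : lsvrgda Fi F Reg gamma x0 (j ^~ t) (c ^~ t) m =
    run (lsvrgda_step Fi F Reg gamma) (x0, x0) (u ^~ t) m.
  by elim: m => //= m ->; case: (run _ _ _ m).
have mu_draw := measurable_draw hdraws.
rewrite (_ : (fun t => _) = (fun t => enorm
    ((run (lsvrgda_step Fi F Reg gamma) (x0, x0) (u ^~ t) k).1 - xs) ^+ 2));
  last by apply/funext => t; rewrite runE.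
(* [V0] is the Lyapunov function at [(x0, x0)]; it remains to dominate the squared distance by the
   Lyapunov function pointwise. *)
apply: le_trans (integral_run_le (x0, x0) mu_draw (prob_cylinder hdraws)
  (fun s => lyapunov_ge0 Fi gamma xs s hp0) rho0 drift k).
rewrite unlock; apply: ge0_le_integral => //.
- by move=> t _; rewrite lee_fin sqr_ge0.
- exact: (measurable_fun_run _ _ mu_draw _ (fun s => enorm (s.1 - xs) ^+ 2)).
- exact: measurable_fun_run.
- by move=> t _; rewrite lee_fin; exact: sqr_enorm_le_lyapunov.
Qed.
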